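(* For every natural number $n$, $wsp(K_n)\leq n+1$, where $K_n$ is the complete graph on $n$ vertices and $wsp(K_n)$ is its weak separation number.
   Context: Let $G$ be a graph. A path system of $G$ is a set of paths in $G$. Given edges $e,f\in E(G)$ and a path system $\mathcal{P}$ of $G$, the edge $e$ is separated from $f$ by $\mathcal{P}$ if there exists a path $P\in\mathcal{P}$ such that $e\in P$ and $f\notin P$. A path system $\mathcal{P}$ weakly separates $G$ if for every pair of distinct edges of $G$ it separates one of them from the other. The weak separation number $wsp(G)$ is the minimum size of a path system of $G$ that weakly separates $G$. *)

(* Defs.v *)
From HB Require Import structures.
From mathcomp Require Import all_boot.

Set Implicit Arguments.
Unset Strict Implicit.
Unset Printing Implicit Defensive.

Record graph (T : finType) := Graph {
  adj : rel T;
  adj_sym : symmetric adj;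
  adj_irrefl : irreflexive adj }.

Section Separation.

Variables (T : finType) (G : graph T).

Definition edges : {set {set T}} :=
  [set [set x; y] | x in T, y in T & adj G x y].

(* A path is a subgraph, given by its vertex set and its edge set, so that a
   vertex sequence and its reversal give the same path and the size of a path
   system is a number of paths. *)
Definition path_of (x : T) (p : seq T) : {set T} * {set {set T}} :=
  ([set:: x :: p], [set:: pairmap (fun a b => [set a; b]) x p]).

(* The length is bounded only to quantify over a finite type; see [is_pathP]. *)
Definition is_path (P : {set T} * {set {set T}}) : bool :=
  [exists k : 'I_#|T|, exists x : T, exists p : k.-tuple T,
    [&& path (adj G) x p, uniq (x :: p) & P == path_of x p]].

Lemma is_pathP P :
  reflect (exists x p, [/\ path (adj G) x p, uniq (x :: p) & P = path_of x p])
          (is_path P).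
Proof.
apply: (iffP existsP) => [[k /existsP[x /existsP[p /and3P[ep up /eqP ->]]]]|].
  by exists x, p.
move=> [x [p [ep up ->]]].
have lt_p : size p < #|T|.
  by have := max_card (mem (x :: p)); rewrite (card_uniqP up).
exists (Ordinal lt_p); apply/existsP; exists x; apply/existsP.
by exists (in_tuple p); rewrite ep up eqxx.
Qed.

Definition path_system (S : {set {set T} * {set {set T}}}) : bool :=
  [forall P in S, is_path P].

Definition separated (S : {set {set T} * {set {set T}}}) (e f : {set T}) :
    bool :=
  [exists P in S, (e \in P.2) && (f \notin P.2)].

Definition weakly_separates (S : {set {set T} * {set {set T}}}) : bool :=
  [forall e in edges, forall f in edges,
    (e != f) ==> separated S e f || separated S f e].

Definition weak_separation_size (m : nat) : bool :=
  [exists S, [&& path_system S, weakly_separates S & #|S| == m]].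

Lemma weak_separation_size_ex : exists m, weak_separation_size m.
Proof.
exists #|[set P | is_path P]|; apply/existsP; exists [set P | is_path P].
rewrite eqxx andbT; apply/andP; split.
  by apply/forall_inP => P; rewrite inE.
apply/forall_inP => e /imset2P[x y _]; rewrite inE => /andP[_ exy] ->.
apply/forall_inP => f _; apply/implyP => nef; apply/orP; left.
apply/existsP; exists (path_of x [:: y]); rewrite !inE eqxx eq_sym nef !andbT.
apply/is_pathP; exists x, [:: y]; split=> //=; first by rewrite exy.
by rewrite inE andbT; apply/eqP => xy; rewrite xy adj_irrefl in exy.
Qed.

Definition wsp : nat := ex_minn weak_separation_size_ex.

End Separation.

Lemma neq_sym (T : finType) : symmetric (fun x y : T => x != y).
Proof. by move=> x y; rewrite eq_sym. Qed.

Lemma neq_irrefl (T : finType) : irreflexive (fun x y : T => x != y).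
Proof. by move=> x; rewrite eqxx. Qed.

Definition complete_graph (n : nat) : graph 'I_n :=
  Graph (@neq_sym 'I_n) (@neq_irrefl 'I_n).

(* Main.v *)
From Stdlib Require Import NArith.
Require Import Defs.
From mathcomp Require Import all_boot all_algebra all_solvable.
From mathcomp Require Import ring zify.

Set Implicit Arguments.
Unset Strict Implicit.
Unset Printing Implicit Defensive.

Import GRing.Theory.

(* Write n = p + f with p a prime such that 2n + 3 <= 3p, and let the vertices be
   F_p together with f extra points. For a primitive root g the cycle
   1, g, g^2, ... on F_p^* has two edges of each difference (up to sign) d, and
   their translates in F_p lie at offset (g + 1)/(g - 1) d. Insert the extra
   points into edges of f chosen differences d_j, cut the cycle at an edge of one
   more difference d_0, and take the p translates of the resulting path. The set
   of translates through an edge is a pair with gap d_j for an edge at an extra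
   point, a pair with gap (g + 1)/(g - 1) d for an edge of a difference d that
   was not chosen, a singleton for an edge of a chosen difference, and empty for
   an edge between extra points. The d_j are chosen so that the first two kinds
   have different gaps. The remaining f + 1 paths consist of an arithmetic
   progression with difference d_j, which covers all but one edge of that
   difference, followed by a path of a system for the f extra points obtained by
   induction: they separate edges within each of the last two kinds.
   Primes p with 2n + 3 <= 3p and p <= n exist for n > 10, by Chebyshev's method
   with the integer (6m)! m! / ((3m)! (2m)!^2). *)

(** * Paths as vertex sequences and the edges they use *)

Section Adjacency.

Variable T : eqType.
Implicit Types (s : seq T) (a b c d : T).

Definition steps s : seq (T * T) := zip s (behead s).

Definition adjacent s : rel T :=
  fun a b => ((a, b) \in steps s) || ((b, a) \in steps s).

Definition same_edge a b c d : bool :=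
  (a == c) && (b == d) || (a == d) && (b == c).

(** In a complete graph the paths are the duplicate-free sequences. A path separates one of two
    edges from the other exactly when it uses one of them only. *)
Definition separating (G : nat -> seq T) (k : nat) : Prop :=
  (forall i, uniq (G i)) /\
  forall a b c d, a != b -> c != d -> ~~ same_edge a b c d ->
    exists2 i, i < k & adjacent (G i) a b != adjacent (G i) c d.

Lemma adjacentC s a b : adjacent s a b = adjacent s b a.
Proof. by rewrite /adjacent orbC. Qed.

Lemma steps_cons a b s : steps (a :: b :: s) = (a, b) :: steps (b :: s).
Proof. by []. Qed.

Lemma steps_cat a s b s' :
  steps ((a :: s) ++ b :: s') =
  steps (a :: s) ++ (last a s, b) :: steps (b :: s').
Proof. by elim: s a => [|x s IHs] a //=; rewrite [in LHS]steps_cons IHs. Qed.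

End Adjacency.

Lemma map_steps (T U : eqType) (h : T -> U) (s : seq T) :
  steps (map h s) = [seq (h e.1, h e.2) | e <- steps s].
Proof.
case: s => // x s; elim: s x => // y s IHs x.
by rewrite steps_cons /= -IHs.
Qed.

Lemma map_adjacent (T U : eqType) (h : T -> U) (s : seq T) a b :
  injective h -> adjacent (map h s) (h a) (h b) = adjacent s a b.
Proof.
move=> injh; have hP x y : ((h x, h y) \in steps (map h s)) = ((x, y) \in steps s).
  rewrite map_steps (mem_map (f := fun e => (h e.1, h e.2)) _ _ (x, y)) //.
  by case=> [x1 x2] [y1 y2] [/injh -> /injh ->].
by rewrite /adjacent !hP.
Qed.

Lemma separating_bij (T U : eqType) (h : T -> U) (G : nat -> seq T) k :
  bijective h -> separating G k -> separating (fun i => map h (G i)) k.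
Proof.
move=> [h' hK h'K] [uG sepG]; have injh := can_inj hK.
split=> [i|a b c d]; first by rewrite map_inj_uniq.
rewrite -[a]h'K -[b]h'K -[c]h'K -[d]h'K /same_edge !(inj_eq injh).
move=> ab cd abcd; have [i ik sep] := sepG _ _ _ _ ab cd abcd.
by exists i; rewrite // !map_adjacent.
Qed.

(** * From separating sequences to path systems *)

Section SetPaths.

Variables (T : finType) (x : T) (p : seq T).

Lemma set2_eq (a b c d : T) :
  ([set a; b] == [set c; d] :> {set T}) = same_edge a b c d.
Proof.
apply/eqP/idP => [/setP E|/orP[/andP[/eqP-> /eqP->]|/andP[/eqP-> /eqP->]] //].
  have := E a; have := E b; have := E c; have := E d.
  rewrite !inE !eqxx !orbT /same_edge /= ![_ == c]eq_sym ![_ == d]eq_sym.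
  by case: (c =P a); case: (c =P b); case: (d =P a); case: (d =P b) => //; intros; subst; rewrite ?eqxx ?orbT //.
by rewrite setUC.
Qed.

Lemma mem_path_of a b :
  ([set a; b] \in (path_of x p).2) = adjacent (x :: p) a b.
Proof.
rewrite inE; elim: p x => [|y q IHq] z //=.
rewrite inE IHq set2_eq /adjacent steps_cons !inE /same_edge !xpair_eqE.
by rewrite orbACA [(a == y) && _]andbC.
Qed.

End SetPaths.

Lemma separating_wsp n (G : nat -> seq 'I_n) k :
  separating G k -> wsp (complete_graph n) <= k.
Proof.
move=> [uG sepG].
suff: exists S, [&& path_system (complete_graph n) S,
    weakly_separates (complete_graph n) S & #|S| <= k].
  move=> [S /and3P[pS wS lekS]]; apply: leq_trans lekS.
  rewrite /wsp; case: ex_minnP => m _; apply; apply/existsP; exists S.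
  by rewrite pS wS eqxx.
case: n => [|n] in G uG sepG *.
  exists set0; rewrite cards0 andbT; apply/andP; split.
    by apply/forall_inP => P; rewrite inE.
  by apply/forall_inP => e /imset2P[[]].
(* An empty sequence becomes the one-vertex path at [ord0], which has no edges either; this takes a
   vertex, hence the separate case n = 0. Sequences may give the same path, so the size is only
   bounded by [k]. *)
exists [set path_of (head ord0 (G i)) (behead (G i)) | i : 'I_k].
apply/and3P; split; last by rewrite (leq_trans (leq_imset_card _ _)) // card_ord.
  apply/forall_inP => P /imsetP[i _ ->]; apply/is_pathP.
  exists (head ord0 (G i)), (behead (G i)).
  case: (G i) (uG i) => [|x p] //= /andP[xp up]; split=> //; last by rewrite xp.
  elim: p x xp up => //= y p IHp x; rewrite inE negb_or => /andP[xy _] /andP[yp up].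
  by rewrite xy IHp.
have adjP i a b : a != b -> ([set a; b] \in
    (path_of (head ord0 (G i)) (behead (G i))).2) = adjacent (G i) a b.
  by move=> ab; rewrite mem_path_of; case: (G i) => [|x p].
apply/forall_inP => e /imset2P[a b _]; rewrite inE => /andP[_ /= ab ->].
apply/forall_inP => e' /imset2P[c d _]; rewrite inE => /andP[_ /= cd ->].
rewrite set2_eq; apply/implyP => abcd; have [i ik] := sepG _ _ _ _ ab cd abcd.
have Pi : path_of (head ord0 (G i)) (behead (G i)) \in
    [set path_of (head ord0 (G i)) (behead (G i)) | i : 'I_k].
  by apply/imsetP; exists (Ordinal ik).
move=> sep; apply/orP.
have [ab_i|nab_i] := boolP (adjacent (G i) a b); [left | right];
  apply/existsP; exists (path_of (head ord0 (G i)) (behead (G i))).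
  by rewrite Pi !adjP // ab_i; move: sep; rewrite ab_i => /negPf; case: adjacent.
by rewrite Pi !adjP // nab_i andbT; move: sep; rewrite (negPf nab_i); case: adjacent.
Qed.

(** * Primes in intervals *)

Definition primes_between a b := [seq p <- index_iota a b | prime p].

Lemma mem_primes_between a b p :
  (p \in primes_between a b) = [&& prime p, a <= p & p < b].
Proof. by rewrite mem_filter mem_index_iota. Qed.

Lemma primes_between_uniq a b : uniq (primes_between a b).
Proof. by rewrite filter_uniq // iota_uniq. Qed.

Lemma prod_primes_dvd (r : seq nat) N : uniq r ->
  (forall p, p \in r -> prime p /\ p %| N) -> \prod_(p <- r) p %| N.
Proof.
elim: r => [|q r IHr] /=; first by rewrite big_nil dvd1n.
move=> /andP[qr ur] rN; rewrite big_cons.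
have [q_prime qN] := rN q (mem_head _ _).
have rN' p : p \in r -> prime p /\ p %| N by move=> pr; apply: rN; rewrite inE pr orbT.
rewrite Gauss_dvd ?qN ?IHr // prime_coprime //.
rewrite big_seq; elim/big_ind: _ => [|x y qx qy|p pr].
- by rewrite dvdn1; apply: contraTneq q_prime => ->.
- by rewrite Euclid_dvdM // negb_or qx.
have [p_prime _] := rN' p pr.
by rewrite dvdn_prime2 //; apply: contraNneq qr => ->.
Qed.

Lemma prod_primes_between a b c : a <= b -> b <= c ->
  \prod_(p <- primes_between a c) p =
  \prod_(p <- primes_between a b) p * \prod_(p <- primes_between b c) p.
Proof.
by move=> ab bc; rewrite /primes_between !big_filter [LHS](big_cat_nat ab bc).
Qed.

Lemma prime_dvd_fact p n : prime p -> (p %| n`!) = (p <= n).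
Proof.
move=> p_prime; apply/idP/idP; last by move=> pn; rewrite dvdn_fact // prime_gt0.
elim: n => [|n IHn]; first by rewrite fact0 dvdn1 => /eqP p1; rewrite p1 in p_prime.
by rewrite factS Euclid_dvdM // => /orP[/dvdn_leq->|/IHn/leqW].
Qed.

Lemma prime_dvd_bin p n k : prime p -> k < p -> n - k < p -> p <= n -> p %| 'C(n, k).
Proof.
move=> p_prime kp nkp pn; have kn : k <= n by lia.
have : p %| n`! by rewrite prime_dvd_fact.
rewrite -(bin_fact kn) Euclid_dvdM // [p %| k`! * _]Euclid_dvdM //.
by rewrite (prime_dvd_fact k) // (prime_dvd_fact (n - k)) // ![p <= _]leqNgt kp nkp orbF.
Qed.

Lemma bin_le_exp2 n k : 'C(n, k) <= 2 ^ n.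
Proof.
have [kn|nk] := leqP k n; last by rewrite bin_small.
rewrite -[2]/(1 + 1) expnDn (bigD1 (Ordinal (kn : k < n.+1))) //=.
by rewrite !exp1n !muln1 leq_addr.
Qed.

(** The two middle coefficients of row 2m + 1 are equal, and their sum is at most 2^(2m + 1). *)
Lemma bin_middle_le m : 'C(m.*2.+1, m) <= 4 ^ m.
Proof.
have lt0 : m < m.*2.+2 by lia.
have lt1 : m.+1 < m.*2.+2 by lia.
rewrite -(leq_pmul2l (isT : 0 < 2)) -[4]/(2 ^ 2) -expnM -expnS mul2n.
rewrite (_ : (2 * m).+1 = m.*2.+1); last by lia.
rewrite -[2 ^ _]/((1 + 1) ^ _) expnDn (bigD1 (Ordinal lt0)) //= (bigD1 (Ordinal lt1)) /=; last first.
  by rewrite -val_eqE /=; lia.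
rewrite !exp1n !muln1 addnA.
have -> : 'C(m.*2.+1, m.+1) = 'C(m.*2.+1, m).
  by rewrite -[RHS]bin_sub; [congr binomial|]; lia.
by rewrite -addnn leq_addr.
Qed.

(** Erdos's induction: an even number above 2 adds no prime, and for n = 2m + 1 the primes in ]m +
    1, n] divide the binomial coefficient of [bin_middle_le]. *)
Lemma primorial_le n : \prod_(p <- primes_between 0 n.+1) p <= 4 ^ n.
Proof.
elim/ltn_ind: n => -[|[|[|n]]] IHn; try by rewrite /primes_between /= ?big_cons big_nil.
have [nodd|neven] := boolP (odd n.+3); last first.
  rewrite (prod_primes_between (b := n.+3)) //.
  rewrite [X in _ * X](_ : _ = 1).
    by rewrite muln1 (leq_trans (IHn n.+2 _)) // leq_exp2l.
  rewrite /primes_between /index_iota subSnn /=.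
  case: ifP => [pn|]; last by rewrite big_nil.
  by have [//|] := even_prime pn; rewrite (negPf neven).
have [m Em] : exists m, n.+3 = m.*2.+1.
  by exists n.+3./2; rewrite -[LHS]odd_double_half nodd.
rewrite Em (prod_primes_between (b := m.+2)) //; last by lia.
have -> : 4 ^ m.*2.+1 = 4 ^ m.+1 * 4 ^ m by rewrite -expnD; congr expn; lia.
apply: leq_mul; first by apply: IHn; lia.
apply: leq_trans (bin_middle_le m); apply: dvdn_leq; first by rewrite bin_gt0; lia.
apply: prod_primes_dvd; first exact: primes_between_uniq.
move=> p; rewrite mem_primes_between => /and3P[p_prime mp pm]; split=> //.
by apply: prime_dvd_bin => //; lia.
Qed.

Lemma prod_primes_between_double m :
  \prod_(p <- primes_between m.+1 m.*2.+1) p <= 4 ^ m.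
Proof.
rewrite -[4]/(2 ^ 2) -expnM mul2n; apply: leq_trans (bin_le_exp2 m.*2 m).
apply: dvdn_leq; first by rewrite bin_gt0; lia.
apply: prod_primes_dvd; first exact: primes_between_uniq.
move=> p; rewrite mem_primes_between => /and3P[p_prime mp pm]; split=> //.
by apply: prime_dvd_bin => //; lia.
Qed.

(** * Legendre's formula and Chebyshev's quotient *)

Lemma logn_fact_trunc p n K : prime p -> n < p ^ K.+1 ->
  logn p n`! = \sum_(1 <= k < K.+1) n %/ p ^ k.
Proof.
move=> p_prime nK; rewrite logn_fact //; have p1 := prime_gt1 p_prime.
(* Terms with p^k > n vanish, so the cut-off at [K] agrees with the cut-off at n in [logn_fact],
   whichever is larger. *)
have tail a b : n < p ^ a.+1 -> a <= b ->
    \sum_(1 <= k < b.+1) n %/ p ^ k = \sum_(1 <= k < a.+1) n %/ p ^ k.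
  move=> na ab; rewrite (big_cat_nat (n := a.+1)) //= [X in _ + X]big_nat_cond [X in _ + X]big1 ?addn0 //.
  move=> k /andP[/andP[ak _] _]; rewrite divn_small //.
  by apply: leq_trans na _; rewrite leq_exp2l.
have [Kn|nK'] := leqP K n; first exact: tail.
apply/esym/tail; last exact: ltnW.
by rewrite (ltn_trans (ltnSn n)) // ltn_expl.
Qed.

(** Removing a multiple of [d] from [m] lowers both sides equally, since 6 + 1 = 3 + 2 * 2; for a
    remainder below [d] the floors take finitely many values. *)
Lemma chebyshev_floor m d : 0 < d ->
  (6 * m) %/ d + m %/ d <= (3 * m) %/ d + ((2 * m) %/ d).*2 + 1.
Proof.
move=> d0; rewrite (divn_eq m d); set q := m %/ d; set r := m %% d.
have rd : r < d by rewrite ltn_mod.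
have E c : (c * (q * d + r)) %/ d = c * q + (c * r) %/ d.
  by rewrite mulnDr mulnA divnMDl.
rewrite !E divnMDl // (divn_small rd).
suff : (6 * r) %/ d <= (3 * r) %/ d + ((2 * r) %/ d).*2 + 1 by lia.
move: (divn_eq (6 * r) d) (ltn_pmod (6 * r) d0) (divn_eq (3 * r) d) (ltn_pmod (3 * r) d0)
      (divn_eq (2 * r) d) (ltn_pmod (2 * r) d0).
have : (6 * r) %/ d < 6 by rewrite ltn_divLR //; lia.
have : (3 * r) %/ d < 3 by rewrite ltn_divLR //; lia.
have : (2 * r) %/ d < 2 by rewrite ltn_divLR //; lia.
move: (_ %/ _) (_ %/ _) (_ %/ _) (_ %% _) (_ %% _) (_ %% _) => a b c x y z.
by case: a => [|[|[|[|[|[|[]]]]]]] //; case: b => [|[|[|[|[|[|[]]]]]]] //; case: c => [|[|[|[|[|[|[]]]]]]] //; lia.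
Qed.

(** The excess vanishes for 1/2 <= m/d < 5/6; this removes the primes between 6m/5 and 2m from the
    quotient. *)
Lemma chebyshev_floor_gap m d : 6 * m < 5 * d -> d <= 2 * m ->
  (6 * m) %/ d + m %/ d <= (3 * m) %/ d + ((2 * m) %/ d).*2.
Proof.
move=> md dm; have d0 : 0 < d by lia.
have m1 : m %/ d = 0 by rewrite divn_small //; lia.
have m2 : 0 < (2 * m) %/ d by rewrite divn_gt0.
have m3 : 0 < (3 * m) %/ d by rewrite divn_gt0 //; lia.
have m6 : (6 * m) %/ d < 5 by rewrite ltn_divLR.
have [m64|m64] := leqP ((6 * m) %/ d) 3; first by lia.
have m32 : 1 < (3 * m) %/ d by move: m64; rewrite !leq_divRL //; lia.
by lia.
Qed.

(* 108 = 6^6 / (3^3 2^4). *)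
Lemma chebyshev_quotient_ge m : 0 < m ->
  108 ^ m * ((3 * m)`! * ((2 * m)`!) ^ 2) <= 4 * m * ((6 * m)`! * m`!).
Proof.
elim: m => // -[_ _|m IHm _]; first by [].
have {}IHm := IHm isT; move: IHm; move: m.+1 => k.
have -> : 6 * k.+1 = (6 * k).+4.+2 by lia.
have -> : 3 * k.+1 = (3 * k).+3 by lia.
have -> : 2 * k.+1 = (2 * k).+2 by lia.
rewrite !factS [108 ^ k.+1]expnS.
move: ((3 * k)`!) ((2 * k)`!) ((6 * k)`!) (k`!) (108 ^ k) => f3 f2 f6 f1 P IH.
(* [c] is common to the growth factors of both sides; without it the step reads 18k(2k + 1) <= (6k +
   1)(6k + 5). *)
pose c := (3 * k).+3 * (3 * k).+2 * (3 * k).+1 * (24 * k.+1 ^ 2 * (2 * k).+1).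
have -> : 108 * P * ((3 * k).+3 * ((3 * k).+2 * ((3 * k).+1 * f3)) *
    ((2 * k).+2 * ((2 * k).+1 * f2)) ^ 2) =
  18 * (2 * k).+1 * c * (P * (f3 * f2 ^ 2)) by rewrite /c; nia.
have -> : 4 * k.+1 * ((6 * k).+4.+2 * ((6 * k).+4.+1 * ((6 * k).+4 * ((6 * k).+3 *
     ((6 * k).+2 * ((6 * k).+1 * f6))))) * (k.+1 * f1)) =
  (6 * k).+1 * (6 * k).+4.+1 * c * (4 * (f6 * f1)) by rewrite /c; nia.
apply: leq_trans (_ : 18 * (2 * k).+1 * c * (4 * k * (f6 * f1)) <= _).
  by rewrite leq_mul2l IH orbT.
have -> : 18 * (2 * k).+1 * c * (4 * k * (f6 * f1)) =
  18 * k * (2 * k).+1 * c * (4 * (f6 * f1)) by lia.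
by rewrite !leq_mul2r; apply/orP; right; apply/orP; right; nia.
Qed.

Lemma dvdn_logn x y : 0 < x -> 0 < y ->
  (forall p, prime p -> logn p x <= logn p y) -> x %| y.
Proof.
move=> x0 y0 le_xy; apply/dvdn_partP => // p.
rewrite mem_primes => /andP[p_prime _].
by rewrite p_part pfactor_dvdn // le_xy.
Qed.

Lemma dvdn_prod_mem (r : seq nat) (F : nat -> nat) p : p \in r -> F p %| \prod_(q <- r) F q.
Proof.
elim: r => // q r IHr; rewrite inE big_cons => /predU1P[<-|/IHr]; first exact: dvdn_mulr.
exact: dvdn_mull.
Qed.

(** By Legendre's formula the exponent of [p] in the quotient is a sum of [K] excesses, each at most
    1; for K = 1 the only one has d = p and vanishes under [chebyshev_floor_gap]. *)
Lemma logn_chebyshev_sub p m K : prime p -> 0 < m -> 6 * m < p ^ K.+1 ->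
  logn p ((6 * m)`! * m`!) <= logn p ((3 * m)`! * (2 * m)`! ^ 2) + K /\
  (K = 1 -> 6 * m < 5 * p -> p <= 2 * m ->
   logn p ((6 * m)`! * m`!) <= logn p ((3 * m)`! * (2 * m)`! ^ 2)).
Proof.
move=> p_prime m0 mK; have p0 := prime_gt0 p_prime.
rewrite !lognM ?muln_gt0 ?fact_gt0 // addnn.
rewrite !(logn_fact_trunc (K := K)) //; try by lia.
split=> [|-> mp pm]; last by rewrite !big_nat1 expn1 chebyshev_floor_gap.
rewrite -big_split /= -[X in _ <= _ + X + _]mul2n big_distrr -big_split /=.
rewrite -[X in _ <= _ + X]muln1 -[X in _ <= _ + X * 1](_ : K.+1 - 1 = K); last by lia.
rewrite -sum_nat_const_nat -big_split /= !big_seq; apply: leq_sum => k _.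
by rewrite mul2n chebyshev_floor // expn_gt0 p0.
Qed.

Lemma prod_small_primes_le s N : 0 < N ->
  \prod_(p <- primes_between 1 s.+1) p ^ trunc_log p N <= N ^ s.
Proof.
move=> N0; rewrite -[s in N ^ s](size_iota 1 s) /primes_between /index_iota subSS subn0.
elim: (iota 1 s) => [|p r IHr]; first by rewrite big_nil.
rewrite [filter _ _]/= [size _]/= expnS; case: ifP => [p_prime|_].
  by rewrite big_cons leq_mul // trunc_logP // prime_gt1.
by apply: leq_trans IHr _; rewrite leq_pmull.
Qed.

(** The quotient divides A * B * C. Primes up to [s] are absorbed by A. A larger prime has square
    above 6m, hence exponent at most 1: it lies in C up to 6m/5, has exponent 0 from there to 2m,
    lies in B up to 4m + 4, and by assumption none follows up to 6m. *)
Lemma chebyshev_quotient_le m s : 0 < m -> 6 * m < s.+1 ^ 2 ->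
  (forall p, prime p -> p <= 6 * m -> p <= 4 * m + 4) ->
  (6 * m)`! * m`! <= (3 * m)`! * (2 * m)`! ^ 2 *
    ((6 * m) ^ (s + 2) * 4 ^ (2 * m + 2) * 4 ^ ((6 * m) %/ 5)).
Proof.
move=> m0 ms gap.
pose A := \prod_(p <- primes_between 1 s.+1) p ^ trunc_log p (6 * m).
pose B := \prod_(p <- primes_between (2 * m).+1 (4 * m + 5)) p.
pose C := \prod_(p <- primes_between 0 ((6 * m) %/ 5).+1) p.
have prime_pos a b : 0 < \prod_(p <- primes_between a b) p.
  by rewrite big_seq prodn_cond_gt0 // => p; rewrite mem_primes_between => /and3P[/prime_gt0].
have A0 : 0 < A.
  rewrite /A big_seq prodn_cond_gt0 // => p; rewrite mem_primes_between => /and3P[/prime_gt0 p0 _ _].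
  by rewrite expn_gt0 p0.
apply: (leq_trans (n := (3 * m)`! * (2 * m)`! ^ 2 * (A * B * C))); last first.
  rewrite leq_mul2l; apply/orP; right; apply: leq_mul; last exact: primorial_le.
  rewrite expnD -mulnA; apply: leq_mul; first by apply: prod_small_primes_le; lia.
  (* The candidates 2m + 1 and 2m + 2 are split off and cost the extra (6m)^2; the rest is an
     interval ]k, 2k] with k = 2m + 2. *)
  rewrite /B (prod_primes_between (b := (2 * m + 2).+1)); try by lia.
  apply: leq_mul; last first.
    rewrite (_ : 4 * m + 5 = (2 * m + 2).*2.+1); last by lia.
    exact: prod_primes_between_double.
  rewrite /primes_between /index_iota (_ : (2 * m + 2).+1 - (2 * m).+1 = 2); last by lia.
  rewrite [iota _ _]/= [filter _ _]/=.
  by do 2 case: ifP => _; rewrite ?big_cons big_nil; nia.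
have Y0 : 0 < (3 * m)`! * (2 * m)`! ^ 2 by rewrite muln_gt0 expn_gt0 !fact_gt0.
have YABC0 : 0 < (3 * m)`! * (2 * m)`! ^ 2 * (A * B * C).
  by rewrite muln_gt0 Y0 !muln_gt0 A0 !prime_pos.
apply: dvdn_leq => //; apply: dvdn_logn => // [|p p_prime].
  by rewrite muln_gt0 !fact_gt0.
rewrite [leqRHS]lognM //; last by rewrite !muln_gt0 A0 !prime_pos.
rewrite (lognM p (m := A * B)) ?muln_gt0 ?A0 ?prime_pos // (lognM p (m := A)) ?A0 ?prime_pos //.
have p1 := prime_gt1 p_prime.
have [pn|np] := leqP p (6 * m); last first.
  have [] := @logn_chebyshev_sub p m 0 p_prime m0; first by rewrite expn1.
  by rewrite addn0 => H _; apply: leq_trans H _; apply: leq_addr.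
have [ps|sp] := leqP p s.
  have [] := @logn_chebyshev_sub p m (trunc_log p (6 * m)) p_prime m0.
    exact: trunc_log_ltn.
  move=> H _; apply: leq_trans H _; rewrite leq_add2l -addnA; apply: leq_trans (leq_addr _ _).
  rewrite -pfactor_dvdn //; apply: (dvdn_prod_mem (fun p => p ^ trunc_log p (6 * m))).
  by rewrite mem_primes_between p_prime ltnS ps prime_gt0.
have [|H1 H2] := @logn_chebyshev_sub p m 1 p_prime m0.
  by apply: leq_trans ms _; rewrite leq_exp2r.
have one_le r : p \in r -> (forall q, q \in r -> prime q) -> 1 <= logn p (\prod_(q <- r) q).
  move=> pr rP; rewrite -(pfactor_dvdn 1) ?expn1 //; first exact: (dvdn_prod_mem id).
  by rewrite big_seq prodn_cond_gt0 // => q /rP/prime_gt0.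
have pr_prime a b q : q \in primes_between a b -> prime q.
  by rewrite mem_primes_between => /and3P[].
have [p5|p5] := ltnP (6 * m) (5 * p); last first.
  have : 1 <= logn p C.
    apply: one_le => [|q /pr_prime //]; rewrite mem_primes_between p_prime ltnS leq_divRL //.
    by rewrite mulnC p5.
  by lia.
have [p2|p2] := leqP p (2 * m).
  by apply: leq_trans (H2 erefl p5 p2) _; rewrite leq_addr.
have : 1 <= logn p B.
  apply: one_le => [|q /pr_prime //]; rewrite mem_primes_between p_prime p2.
  by have := gap p p_prime pn; lia.
by lia.
Qed.

(** * A prime between 4m + 4 and 6m for large m *)

Lemma sqr_le_exp2 t : 17 <= t -> (18 * t.+1) ^ 2 <= 2 ^ t.
Proof.
elim: t => // t IHt; rewrite leq_eqVlt => /predU1P[<-|t17].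
  rewrite (expnD 2 8 9) [leqLHS](_ : _ = 324 * 324); last by rewrite -mulnn; congr muln; lia.
  by rewrite -[2 ^ 8]/256 -[2 ^ 9]/512; lia.
apply: (leq_trans (n := 2 * (18 * t.+1) ^ 2)); last by rewrite [leqRHS]expnS leq_mul2l IHt ?orbT.
by rewrite -!mulnn; nia.
Qed.

(** As 108 = 4 * 27, this reduces to 2^19 <= 27^4; the powers are split to keep unary numerals
    small. *)
Lemma exp2_135_le : 2 ^ 135 <= 108 ^ 20.
Proof.
have E : 2 ^ 19 <= 27 ^ 4.
  rewrite (expnD 2 9 10) (expnD 27 2 2) -[2 ^ 9]/512 -[2 ^ 10]/(512 * 2).
  by rewrite -[27 ^ 2]/729; lia.
rewrite -[108]/(2 ^ 2 * 27) expnMn -expnM (expnD 2 40 95) (expnM 2 19 5) (expnM 27 4 5).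
by rewrite leq_mul2l leq_exp2r // E orbT.
Qed.

Lemma sqrt_exists N : exists s, s ^ 2 <= N < s.+1 ^ 2.
Proof.
elim: N => [|N [s /andP[sN Ns]]]; first by exists 0.
have [Ns'|sN'] := ltnP N.+1 (s.+1 ^ 2); first by exists s; rewrite Ns' andbT ltnW.
exists s.+1; rewrite sN' (leq_ltn_trans Ns) // ltn_exp2r //.
Qed.

(* Without primes in ]4m + 4, 6m] the quotient is at most 4^(2m + 6m/5), up to
   subexponential factors, and 108^20 >= 2^135 while 4^(20 (2 + 6/5)) = 2^128. *)
Lemma prime_gap_large m : 306 ^ 2 <= 6 * m ->
  exists p, [/\ prime p, p <= 6 * m & 4 * m + 4 < p].
Proof.
move=> m_large; have m0 : 0 < m by case: m m_large.
suff /hasP[p] : has (fun p => prime p && (4 * m + 4 < p)) (iota 0 (6 * m).+1).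
  by rewrite mem_iota => pm /andP[? ?]; exists p.
apply/negPn/negP => /hasPn no_prime.
have gap p : prime p -> p <= 6 * m -> p <= 4 * m + 4.
  move=> p_prime pm; have pi : p \in iota 0 (6 * m).+1 by rewrite mem_iota.
  by have := no_prime p pi; rewrite p_prime -leqNgt.
have [s /andP[sm ms]] := sqrt_exists (6 * m).
have s306 : 306 <= s by rewrite -ltnS -(@ltn_exp2r _ _ 2) // (leq_ltn_trans m_large).
(* Since 306 = 18 * 17, q is at least 17 and [sqr_le_exp2] yields 6m < 2^q. *)
pose q := s %/ 18.
have sq : s < 18 * q.+1 by rewrite mulnC ltn_ceil.
have qs : 18 * q <= s by rewrite mulnC leq_divM.
have mq : 6 * m < 2 ^ q.
  apply: leq_trans (sqr_le_exp2 _); last by rewrite leq_divRL.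
  by apply: leq_trans ms _; rewrite leq_exp2r.
have Y0 : 0 < (3 * m)`! * (2 * m)`! ^ 2 by rewrite muln_gt0 expn_gt0 !fact_gt0.
have le1 : 108 ^ m <= (6 * m) ^ (s + 3) * 4 ^ (2 * m + 2) * 4 ^ ((6 * m) %/ 5).
  rewrite -(leq_pmul2r Y0); apply: leq_trans (chebyshev_quotient_ge m0) _.
  apply: leq_trans (leq_mul (leqnn _) (chebyshev_quotient_le m0 ms gap)) _.
  rewrite (_ : s + 3 = (s + 2).+1) ?addnS // expnS.
  rewrite [leqRHS]mulnC [leqLHS]mulnCA leq_pmul2l // -!mulnA.
  by rewrite leq_mul2r; apply/orP; right; lia.
(* The 20th power makes the exponents integral: 108^20 >= 2^135, while the two powers of 4 give
   2^(80m + 80) and at most 2^(48m). *)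
have le20 : 2 ^ (135 * m) <= 2 ^ (q * (20 * s + 60) + 128 * m + 80).
  apply: (leq_trans (n := (108 ^ m) ^ 20)).
    rewrite expnM [leqRHS]expnAC leq_exp2r; last exact: m0.
    exact: exp2_135_le.
  apply: (leq_trans (n := ((6 * m) ^ (s + 3) * 4 ^ (2 * m + 2) * 4 ^ ((6 * m) %/ 5)) ^ 20)).
    by rewrite leq_exp2r.
  rewrite expnMn expnMn -!expnM -addnA expnD -mulnA.
  apply: leq_mul.
    rewrite (_ : (s + 3) * 20 = 20 * s + 60); last by lia.
    by rewrite [leqRHS]expnM leq_exp2r ?(ltnW mq) //; lia.
  rewrite -[4]/(2 ^ 2) -!expnM -expnD leq_exp2l //.
  by have := leq_divM (6 * m) 5; lia.
move: le20; rewrite leq_exp2l // => le20.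
have {}le20 : 7 * m <= q * (20 * s + 60) + 80 by lia.
(* With 18q <= s and s^2 <= 6m, the left side is at least (21/18) s^2 and the right at most (20/18)
   s^2 plus lower terms, impossible for s >= 306. *)
by rewrite -mulnn in sm; nia.
Qed.

(** * Small primes by computation *)

Section TrialDivision.

Variable b : nat.

(** Binary numbers make this fast to evaluate. The divisors tried are 2, ..., b + 1, and those with
    square above [p] pass. *)
Definition trial_division (p : N) : bool :=
  all (fun d => N.ltb p (N.mul (N.of_nat d) (N.of_nat d)) ||
                ~~ N.eqb (N.modulo p (N.of_nat d)) 0%num) (iota 2 b).

Lemma trial_divisionP p : N.lt 1 p -> N.to_nat p < b.+2 ^ 2 -> trial_division p ->
  prime (N.to_nat p).
Proof.
move=> p1 pb /allP td; apply: ltn_pdiv2_prime; first by lia.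
rewrite ltnNge; apply/negP => dp; set d := pdiv _ in dp.
have d_prime : prime d by apply: pdiv_prime; lia.
have db : d < b.+2 by rewrite -(@ltn_exp2r _ _ 2) // (leq_ltn_trans dp).
have := td d; rewrite mem_iota prime_gt1 //= add2n db => /(_ isT)/orP[].
  by rewrite -mulnn in dp; lia.
have /dvdnP[k Ek] := pdiv_dvd (N.to_nat p).
have -> : p = N.mul (N.of_nat k) (N.of_nat d) by rewrite -/d in Ek; lia.
by rewrite N.Div0.mod_mul.
Qed.

End TrialDivision.

(* Every p in s is a prime that serves all n with p <= n <= (3p - 3)/2, and
   these intervals cover [lo, hi[. *)
Fixpoint prime_chain (lo : N) (s : seq N) (hi : N) : bool :=
  if s is p :: s' then
    [&& N.leb p lo, N.ltb 1 p, N.ltb p (N.mul 307 307), trial_division 305 p &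
        prime_chain (N.div (N.sub (N.mul 3 p) 1) 2) s' hi]
  else N.leb hi lo.

Lemma prime_chainP lo s hi n : prime_chain lo s hi ->
  N.le lo (N.of_nat n) -> N.lt (N.of_nat n) hi ->
  exists p, [/\ prime p, p <= n & 2 * n + 3 <= 3 * p].
Proof.
elim: s lo => [|p s IHs] lo; first by move=> /N.leb_le; lia.
case/and5P => /N.leb_le plo /N.ltb_lt p1 /N.ltb_lt pb td chain lon nhi.
have [np|np] := leqP (2 * n + 3) (3 * N.to_nat p); last first.
  by apply: IHs chain _ nhi; have := N.Div0.mul_div_le (N.sub (N.mul 3 p) 1) 2; lia.
exists (N.to_nat p); split=> //; last by lia.
by apply: (@trial_divisionP 305) => //; rewrite -mulnn; lia.
Qed.

Lemma prime_interval n : 10 < n -> exists p, [/\ prime p, p <= n & 2 * n + 3 <= 3 * p].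
Proof.
move=> n10; have [n_large|n_small] := leqP (306 ^ 2) n; last first.
  apply: (@prime_chainP 11%num [:: 11; 13; 19; 23; 31; 43; 61; 89; 131; 193; 283;
    421; 631; 941; 1409; 2113; 3169; 4751; 7121; 10667; 15991; 23981; 35969;
    53951; 80923]%num (N.mul 306 306)); first by vm_compute.
  - by lia.
  - by rewrite -mulnn in n_small; lia.
(* From n <= 6m + 5 and p >= 4m + 5 follows 2n + 3 <= 12m + 13 <= 3p. *)
have [|p [p_prime pm mp]] := @prime_gap_large (n %/ 6).
  by move: n_large; rewrite -!mulnn; lia.
by exists p; split=> //; lia.
Qed.
(** * Rotations of a path in a finite field *)

Local Open Scope ring_scope.

Lemma steps_mkseq (T : eqType) (h : nat -> T) n :
  steps (mkseq h n) = mkseq (fun i => (h i, h i.+1)) n.-1.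
Proof.
case: n => // n; rewrite /mkseq; elim: n 0%N => // n IHn m.
by rewrite [iota _ _]/= 2!map_cons steps_cons -map_cons -[m.+1 :: _]/(iota m.+1 n.+1) IHn.
Qed.

Section Rotations.

Variables (F : finFieldType) (f : nat) (g : F) (e : 'I_f.+1 -> F).
Hypotheses (g_neq1 : g != 1) (g_neqN1 : g != -1).
Hypothesis e_neq0 : forall i, e i != 0.
Hypothesis e_inj : injective e.
Hypothesis e_opp : forall i j, e i != - e j.

(* The path traverses F^* and is cut after e ord0; the extra point j is inserted
   right after e (lift ord0 j). *)
Notation vertex := (F + 'I_f)%type.

Definition insert (x : F) : seq vertex :=
  if [pick j | e (lift ord0 j) == x] is Some j then [:: inr j] else [::].

Lemma insertP x v : (v \in insert x) = (if v is inr j then e (lift ord0 j) == x else false).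
Proof.
rewrite /insert; case: pickP => [j /eqP <-|nox].
  rewrite inE; case: v => [y|i]; first by [].
  by rewrite (inj_eq e_inj) (inj_eq (@lift_inj _ ord0)) -[inr i == inr j]/(i == j).
by case: v => [y|i] //; rewrite nox in_nil.
Qed.

Lemma insert_nil x : (insert x == [::]) = [forall j, e (lift ord0 j) != x].
Proof.
apply/eqP/forallP => [x0 j|nox].
  by have := insertP x (inr j); rewrite x0 in_nil => <-.
case Ex : (insert x) => [|v s] //; have := insertP x v.
by rewrite Ex inE eqxx; case: v {Ex} => // j /esym; rewrite (negPf (nox j)).
Qed.

Definition block x : seq vertex := inl x :: insert x.

Definition base_path (s : seq F) : seq vertex := flatten [seq block x | x <- s].

Arguments base_path : simpl never.

Lemma base_path_cons x s : base_path (x :: s) = block x ++ base_path s.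
Proof. by []. Qed.

Lemma mem_base_path s v :
  (v \in base_path s) =
  match v with inl x => x \in s | inr j => e (lift ord0 j) \in s end.
Proof.
elim: s => [|x s IHs]; first by case: v.
rewrite base_path_cons mem_cat {}IHs inE insertP; case: v => [y|j].
  by rewrite orbF inE.
by rewrite inE.
Qed.

Lemma uniq_base_path s : uniq s -> uniq (base_path s).
Proof.
elim: s => // x s IHs; rewrite cons_uniq => /andP[xs us].
rewrite base_path_cons cat_uniq IHs // andbT; apply/andP; split.
  rewrite /= insertP /= /insert; by case: pickP.
apply/hasPn => v; rewrite mem_base_path inE insertP; case: v => [y ys|j js].
  by rewrite orbF; apply: contra xs => /eqP[<-].
by apply: contra xs => /eqP <-.
Qed.

(** A step from a to ga survives when nothing is inserted at a, and otherwise becomes two steps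
    through the extra point. The last element starts no step, hence [belast]. *)
Lemma steps_base_path x s u v :
    path (fun y z => z == g * y) x s -> insert (last x s) = [::] ->
  ((u, v) \in steps (base_path (x :: s))) =
  match u, v with
  | inl a, inl b => [&& a \in belast x s, b == g * a & insert a == [::]]
  | inl a, inr j => (a \in belast x s) && (e (lift ord0 j) == a)
  | inr j, inl b => (e (lift ord0 j) \in belast x s) && (b == g * e (lift ord0 j))
  | inr _, inr _ => false
  end.
Proof.
elim: s x => [|y s IHs] x /=.
  by move=> _ x0; rewrite base_path_cons /= /block x0; case: u v => [a|i] [b|j].
move=> /andP[/eqP gxy ys] lasts.
rewrite base_path_cons base_path_cons [steps _](steps_cat (inl x) (insert x) (inl y)).
rewrite -[inl y :: _]/(base_path (y :: s)).
rewrite mem_cat inE {}IHs //.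
have Ex := insertP x.
have : insert x = [::] \/ exists2 k, insert x = [:: inr k] & e (lift ord0 k) = x.
  by rewrite /insert; case: pickP => [k /eqP|]; [right; exists k | left].
have inlE (a b : F) : (inl a == inl b :> vertex) = (a == b) by [].
have inrE (i j : 'I_f) : (inr i == inr j :> vertex) = (i == j) by [].
case=> [x0|[k xk ek]].
  have Ej j : (e (lift ord0 j) == x) = false.
    by have := Ex (inr j); rewrite x0 in_nil => <-.
  rewrite x0 /=; case: u v => [a|i] [b|j]; rewrite !xpair_eqE ?inE /= ?andbF ?orFb ?inE //.
  - by rewrite !inlE gxy; case: (a =P x) => // ->; rewrite x0 eqxx andbT /= orb_idr // => /andP[].
  - by case: (a =P x) => // ->; rewrite Ej !andbF.
  - by rewrite Ej.
have kE j : (e (lift ord0 j) == x) = (j == k).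
  by rewrite -ek (inj_eq e_inj) (inj_eq (@lift_inj _ ord0)).
have xN : (insert x == [::]) = false by rewrite xk.
rewrite xk /=; case: u v => [a|i] [b|j]; rewrite !inE !xpair_eqE ?inlE ?inrE ?andbF ?orFb //=.
- by case: (a =P x) => // ->; rewrite xN !andbF.
- by case: (a =P x) => //= ->; rewrite kE orb_idr // => /andP[].
- rewrite kE; case: (i =P k) => //= ->; rewrite ek -gxy orb_idr // => /andP[] //.
Qed.

Variables (x0 : F) (xs : seq F).
Hypothesis xs_path : path (fun y z => z == g * y) x0 xs.
Hypothesis xs_uniq : uniq (x0 :: xs).
Hypothesis mem_xs : forall y, (y \in x0 :: xs) = (y != 0).
Hypothesis last_xs : last x0 xs = e ord0.

Lemma insert_last : insert (last x0 xs) = [::].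
Proof.
apply/eqP; rewrite last_xs insert_nil; apply/forallP => j.
by rewrite (inj_eq e_inj).
Qed.

Lemma mem_belast_xs y : (y \in belast x0 xs) = (y != 0) && (y != e ord0).
Proof.
have := xs_uniq; rewrite lastI rcons_uniq last_xs -mem_xs lastI last_xs mem_rcons inE.
by case/andP=> /negPf ye _; case: (y =P e ord0) => [->|_] /=; rewrite ?andbF ?andbT.
Qed.

Let Q := base_path (x0 :: xs).

(** The cut removes the edge at [e ord0] and the insertions those at the other [e i], so both losses
    merge into [codom e]. *)
Lemma insert_belast y :
  (y \in belast x0 xs) && (insert y == [::]) = (y != 0) && (y \notin codom e).
Proof.
rewrite mem_belast_xs insert_nil -andbA; congr (_ && _).
apply/andP/idP => [[y0 /forallP yj]|ye].
  apply/codomP => -[i yi]; move: y0 yj; rewrite yi.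
  case: (unliftP ord0 i) => [j ->|->] => [_ /(_ j)|]; by rewrite eqxx.
split; first by apply: contraNneq ye => ->; apply: codom_f.
by apply/forallP => j; apply: contraNneq ye => <-; apply: codom_f.
Qed.

Lemma adjacent_base_ll a b : adjacent Q (inl a) (inl b) =
  [&& b == g * a, a != 0 & a \notin codom e] ||
  [&& a == g * b, b != 0 & b \notin codom e].
Proof.
rewrite /adjacent !steps_base_path //; try exact: insert_last.
by rewrite ![[&& _ \in _, _ & _]]andbCA !insert_belast.
Qed.

Lemma adjacent_base_lr a j : adjacent Q (inl a) (inr j) =
  (a == e (lift ord0 j)) || (a == g * e (lift ord0 j)).
Proof.
rewrite /adjacent !steps_base_path //; try exact: insert_last.
rewrite !mem_belast_xs e_neq0 (inj_eq e_inj) /= [e _ == a]eq_sym.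
by case: (a =P e (lift ord0 j)) => [->|_]; rewrite ?andbF ?e_neq0 ?(inj_eq e_inj).
Qed.

Lemma adjacent_base_rr i j : adjacent Q (inr i) (inr j) = false.
Proof. by rewrite /adjacent !steps_base_path //; exact: insert_last. Qed.

(** * The rotations that use a given edge *)

Definition shift (t : F) (v : vertex) : vertex :=
  if v is inl x then inl (x + t) else v.

Lemma shift_inj t : injective (shift t).
Proof. by case=> [x|i] [y|j] //= [] /addIr ->. Qed.

Definition rotation (t : F) := map (shift t) Q.

Lemma adjacent_rotation t u v :
  adjacent (rotation t) u v = adjacent Q (shift (- t) u) (shift (- t) v).
Proof.
have K w : shift t (shift (- t) w) = w by case: w => //= x; rewrite subrK.
by rewrite -{1}[u]K -{1}[v]K map_adjacent //; exact: shift_inj.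
Qed.

(** The x for which (a, b) is a translate of the step (x, g * x). *)
Definition slope (a b : F) := (b - a) / (g - 1).

(** The translations t for which [rotation t] uses the edge. An edge of F arises from its two
    orientations, with starts s and - s; an orientation is dropped when its start lies in
    [codom e]. *)
Definition signature (u v : vertex) : seq F :=
  match u, v with
  | inl a, inl b => let s := slope a b in
     [seq x <- [:: a - s] | s \notin codom e] ++
     [seq x <- [:: b + s] | - s \notin codom e]
  | inl a, inr j | inr j, inl a =>
     [:: a - e (lift ord0 j); a - g * e (lift ord0 j)]
  | inr _, inr _ => [::]
  end.

Lemma slope_opp a b : slope b a = - slope a b.
Proof. by rewrite /slope -mulNr opprB. Qed.

Lemma slopeE a b : b = a + (g - 1) * slope a b.
Proof. by rewrite /slope mulrC divfK ?subr_eq0 // addrC subrK. Qed.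

Lemma slope_eq0 a b : (slope a b == 0) = (a == b).
Proof.
by rewrite mulf_eq0 invr_eq0 !subr_eq0 (negPf g_neq1) orbF eq_sym.
Qed.

Lemma rotation_signature t u v : u != v ->
  adjacent (rotation t) u v = (t \in signature u v).
Proof.
have step a b : a != b -> [&& b - t == g * (a - t), a - t != 0 & a - t \notin codom e] =
    (t == a - slope a b) && (slope a b \notin codom e).
  move=> ab; have s0 : slope a b != 0 by rewrite slope_eq0.
  have -> : (b - t == g * (a - t)) = (a - t == slope a b).
    rewrite {1}(slopeE a b); apply/eqP/eqP => [E|<-]; last by ring.
    apply: (mulfI (_ : g - 1 != 0)); first by rewrite subr_eq0.
    have -> : (g - 1) * slope a b = a + (g - 1) * slope a b - t - (a - t) by ring.
    by rewrite E; ring.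
  rewrite [t == _](_ : _ = (a - t == slope a b)).
    by case: eqP => // ->; rewrite s0.
  by apply/eqP/eqP => [->|<-]; ring.
have swap a z : (a - t == z) = (t == a - z).
  by rewrite [RHS]eq_sym !subr_eq addrC.
move=> uv; rewrite adjacent_rotation; case: u v uv => [a|i] [b|j] uv /=.
- have ab : a != b by apply: contraNneq uv => ->.
  have ba : b != a by rewrite eq_sym.
  rewrite adjacent_base_ll !step // slope_opp opprK mem_cat /=.
  by case: (_ \notin _); case: (_ \notin _); rewrite ?inE ?andbT ?andbF.
- by rewrite adjacent_base_lr !inE !swap.
- by rewrite adjacentC adjacent_base_lr !inE !swap.
- by rewrite adjacent_base_rr.
Qed.

(** The signatures are empty, a singleton, a pair with gap (g + 1) times the slope, and a pair with
    gap (g - 1) times [e (lift ord0 j)]. In [EdgeShort] the ends are ordered so that the slope is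
    [e i]; by [e_opp] the reverse slope is no value of [e]. *)
Variant edge_kind (u v : vertex) : Prop :=
  | EdgeRR i j of u = inr i & v = inr j
  | EdgeShort a b i of same_edge u v (inl a) (inl b) & slope a b = e i
      & signature u v =i [:: b + e i]
  | EdgeLong a b of same_edge u v (inl a) (inl b) & slope a b \notin codom e
      & - slope a b \notin codom e & a != b
      & signature u v =i [:: a - slope a b; b + slope a b]
  | EdgeLR a j of same_edge u v (inl a) (inr j)
      & signature u v =i [:: a - e (lift ord0 j); a - g * e (lift ord0 j)].

Lemma edge_kindP u v : u != v -> edge_kind u v.
Proof.
case: u v => [a|i] [b|j] uv.
- have oppN i : - e i \notin codom e.
    by apply/codomP => -[k /eqP]; rewrite eq_sym; apply/negP; exact: e_opp.
  have [/codomP[i si]|s1] := boolP (slope a b \in codom e).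
    apply: (EdgeShort (a := a) (b := b) _ si); first by rewrite /same_edge !eqxx.
    by move=> x /=; rewrite si codom_f (negPf (oppN i)).
  have [/codomP[i si]|s2] := boolP (- slope a b \in codom e).
    rewrite -slope_opp in si.
    apply: (EdgeShort (a := b) (b := a) _ si); first by rewrite /same_edge !eqxx orbT.
    by move=> x /=; rewrite -[slope a b]opprK -slope_opp si opprK codom_f (negPf (oppN i)).
  apply: (EdgeLong (a := a) (b := b)) => //; first by rewrite /same_edge !eqxx.
  by move=> x /=; rewrite s1 s2.
- by apply: (EdgeLR (a := a) (j := j)) => //; rewrite /same_edge !eqxx.
- by apply: (EdgeLR (a := b) (j := i)) => //; rewrite /same_edge !eqxx orbT.
- exact: EdgeRR.
Qed.

(** * Edges with equal signatures *)

Lemma mem2_eq (T : eqType) (x y z t : T) : x != y -> [:: x; y] =i [:: z; t] ->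
  x = z /\ y = t \/ x = t /\ y = z.
Proof.
move=> xy E; have := E x; have := E y; rewrite !inE !eqxx ?orbT.
move=> /esym/orP[/eqP<-|/eqP<-] /esym/orP[/eqP xz|/eqP xt]; subst;
 by [rewrite eqxx in xy | left | right].
Qed.

Lemma mem1_neq2 (T : eqType) (x y z : T) : x != y -> ~ [:: x; y] =i [:: z].
Proof.
move=> xy E; have := E x; have := E y; rewrite !inE !eqxx ?orbT.
by move=> /esym/eqP yz /esym/eqP xz; rewrite yz xz eqxx in xy.
Qed.

Hypothesis e_closed :
  forall j, exists i, (g - 1) * e (lift ord0 j) = (g + 1) * e i \/
    (g - 1) * e (lift ord0 j) = - ((g + 1) * e i).

Let gB1_neq0 : g - 1 != 0. Proof. by rewrite subr_eq0. Qed.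
Let gD1_neq0 : g + 1 != 0. Proof. by rewrite addr_eq0. Qed.

Lemma long_ends_neq a b : a != b -> a - slope a b != b + slope a b.
Proof.
move=> ab; rewrite {2}(slopeE a b) -subr_eq0.
have -> : a - slope a b - (a + (g - 1) * slope a b + slope a b) = - ((g + 1) * slope a b) by ring.
by rewrite oppr_eq0 mulf_neq0 ?slope_eq0.
Qed.

Lemma cross_ends_neq (a : F) j : a - e j != a - g * e j.
Proof.
rewrite -subr_eq0; have -> : a - e j - (a - g * e j) = (g - 1) * e j by ring.
by rewrite mulf_neq0.
Qed.

Lemma same_edge_trans (T : eqType) (u v x y w z : T) :
  same_edge u v x y -> same_edge w z x y -> same_edge u v w z.
Proof.
by rewrite /same_edge => /orP[]/andP[/eqP<- /eqP<-] /orP[]/andP[/eqP-> /eqP->];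
  rewrite !eqxx ?orbT.
Qed.

(** By [e_closed] the gap of a cross edge is, up to sign, (g + 1) times a value of [e], which no
    long edge has. Within either of these kinds the pair determines the edge, so only empty and
    singleton signatures stay ambiguous. *)
Lemma signature_eq u v w z : u != v -> w != z -> signature u v =i signature w z ->
  [\/ same_edge u v w z,
      exists i j k l, [/\ u = inr i, v = inr j, w = inr k & z = inr l] |
      exists a b i c d j,
        [/\ same_edge u v (inl a) (inl b) /\ slope a b = e i,
            same_edge w z (inl c) (inl d) /\ slope c d = e j &
            b + e i = d + e j] ].
Proof.
have long_cross a b c j : slope a b \notin codom e -> - slope a b \notin codom e ->
    a != b -> ~ [:: a - slope a b; b + slope a b] =i
                [:: c - e (lift ord0 j); c - g * e (lift ord0 j)].
  move=> s1 s2 ab; case/(mem2_eq (long_ends_neq ab)) => -[E1 E2].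
    have E : (g - 1) * e (lift ord0 j) = - ((g + 1) * slope a b).
      transitivity ((a - slope a b) - (b + slope a b)).
        by rewrite E1 E2; ring.
      by rewrite {2}(slopeE a b); ring.
    have [i [Ei|Ei]] := e_closed j; rewrite Ei in E.
      by case/negP: s2; rewrite -(_ : e i = - slope a b) ?codom_f //; apply: (mulfI gD1_neq0); rewrite E; ring.
    by case/negP: s1; rewrite -(_ : e i = slope a b) ?codom_f //; apply: (mulfI gD1_neq0); apply: oppr_inj.
  have E : (g - 1) * e (lift ord0 j) = ((g + 1) * slope a b).
    transitivity ((b + slope a b) - (a - slope a b)).
      by rewrite E1 E2; ring.
    by rewrite {1}(slopeE a b); ring.
  have [i [Ei|Ei]] := e_closed j; rewrite Ei in E.
    by case/negP: s1; rewrite -(_ : e i = slope a b) ?codom_f //; apply: (mulfI gD1_neq0).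
  by case/negP: s2; rewrite -(_ : e i = - slope a b) ?codom_f //; apply: (mulfI gD1_neq0); rewrite mulrN -E opprK.
have sym (s1 s2 : seq F) : s1 =i s2 -> s2 =i s1 by move=> E x; rewrite E.
move=> /edge_kindP uv /edge_kindP wz.
case: uv => [i j -> ->|a b i uv si suv|a b uv s1 s2 ab suv|a j uv suv];
case: wz => [k l -> ->|c d k wz sk swz|c d wz t1 t2 cd swz|c l wz swz] E.
- by constructor 2; exists i, j, k, l.
- by have := E (d + e k); rewrite swz inE eqxx.
- by have := E (c - slope c d); rewrite swz inE eqxx.
- by have := E (c - e (lift ord0 l)); rewrite swz inE eqxx.
- by have := E (b + e i); rewrite suv inE eqxx.
- constructor 3; exists a, b, i, c, d, k; split=> //.
  by have := E (b + e i); rewrite suv swz !inE eqxx => /esym/eqP.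
- by case: (mem1_neq2 (z := b + e i) (long_ends_neq cd)) => x; rewrite -swz -E suv.
- by case: (mem1_neq2 (z := b + e i) (cross_ends_neq c (lift ord0 l))) => x; rewrite -swz -E suv.
- by have := E (a - slope a b); rewrite suv inE eqxx.
- by case: (mem1_neq2 (z := d + e k) (long_ends_neq ab)) => x; rewrite -suv E swz.
- have {}E : [:: a - slope a b; b + slope a b] =i [:: c - slope c d; d + slope c d].
    by move=> x; rewrite -suv E swz.
  constructor 1; apply: (same_edge_trans uv).
  case: (mem2_eq (long_ends_neq ab) E) => -[E1 E2].
    have ss : slope a b = slope c d.
      apply: (mulfI gD1_neq0).
      have -> : (g + 1) * slope a b = (a + (g - 1) * slope a b + slope a b) - (a - slope a b) by ring.
      by rewrite -slopeE E1 E2 {1}(slopeE c d); ring.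
    rewrite ss in E1 E2; move: E1 E2 => /addIr ac /addIr bd.
    by rewrite ac bd.
  (* Matching the pairs crosswise reverses the slope: it is the same edge read backwards. *)
  have ss : slope a b = - slope c d.
    apply: (mulfI gD1_neq0).
    have -> : (g + 1) * slope a b = (a + (g - 1) * slope a b + slope a b) - (a - slope a b) by ring.
    by rewrite -slopeE E1 E2 {2}(slopeE c d); ring.
  rewrite ss opprK in E1 E2; move: E1 E2 => /addIr ad /addIr bc.
  by rewrite ad bc /same_edge; move: wz; rewrite /same_edge orbC.
- by case: (long_cross a b c l) => // x; rewrite -suv E swz.
- by have := E (a - e (lift ord0 j)); rewrite suv inE eqxx.
- by case: (mem1_neq2 (z := d + e k) (cross_ends_neq a (lift ord0 j))) => x; rewrite -suv E swz.
- by case: (long_cross c d a j) => // x; rewrite -swz -E suv.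
- have {}E : [:: a - e (lift ord0 j); a - g * e (lift ord0 j)] =i
             [:: c - e (lift ord0 l); c - g * e (lift ord0 l)].
    by move=> x; rewrite -suv E swz.
  constructor 1; apply: (same_edge_trans uv).
  case: (mem2_eq (cross_ends_neq a (lift ord0 j)) E) => -[E1 E2].
    have ee : e (lift ord0 j) = e (lift ord0 l).
      apply: (mulfI gB1_neq0).
      have -> : (g - 1) * e (lift ord0 j) = (a - e (lift ord0 j)) - (a - g * e (lift ord0 j)) by ring.
      by rewrite E1 E2; ring.
    move: (E1); rewrite ee => /addIr ->.
    by move: ee => /e_inj/lift_inj ->.
  have ee : e (lift ord0 j) = - e (lift ord0 l).
    apply: (mulfI gB1_neq0).
    have -> : (g - 1) * e (lift ord0 j) = (a - e (lift ord0 j)) - (a - g * e (lift ord0 j)) by ring.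
    by rewrite E1 E2; ring.
  by case/eqP: (e_opp (lift ord0 j) (lift ord0 l)).
Qed.

End Rotations.

(** * The cycle of powers of a primitive root *)

Lemma iter_mull (R : pzSemiRingType) (g u : R) m : iter m ( *%R g) u = g ^+ m * u.
Proof. by elim: m => [|m /= ->]; rewrite ?expr0 ?mul1r // exprS mulrA. Qed.

Lemma prim_root_neq0 (F : fieldType) n (g : F) : n.-primitive_root g -> g != 0.
Proof.
move=> g_prim; apply/eqP => g0; have /esym/eqP := prim_expr_order g_prim.
by rewrite g0 expr0n gtn_eqF ?(prim_order_gt0 g_prim) // oner_eq0.
Qed.

Section PrimitiveCycle.

Variables (F : finFieldType) (n : nat) (g : F).
Hypothesis cardF : #|F| = n.+2.
Hypothesis g_prim : n.+1.-primitive_root g.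

Lemma primitive_traject_uniq u : u != 0 -> uniq (traject ( *%R g) u n.+1).
Proof.
move=> u0.
apply/(uniqP u) => i j; rewrite !inE !size_traject => ip jp.
rewrite !nth_traject // !iter_mull => /(mulIf u0) /eqP.
by rewrite (eq_prim_root_expr g_prim) !modn_small // => /eqP.
Qed.

Lemma mem_primitive_traject u y : u != 0 -> (y \in traject ( *%R g) u n.+1) = (y != 0).
Proof.
move=> u0.
have g0 := prim_root_neq0 g_prim.
have sub : {subset traject ( *%R g) u n.+1 <= [pred z | z != 0]}.
  by move=> z /trajectP[i _ ->]; rewrite inE iter_mull mulf_neq0 // expf_neq0.
have sub' : {subset traject ( *%R g) u n.+1 <= enum [pred z : F | z != 0]}.
  by move=> z /sub; rewrite mem_enum.
have [|_ ->] := uniq_min_size (primitive_traject_uniq u0) sub'.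
  rewrite size_traject -cardE; move: cardF.
  by rewrite (cardD1 0) inE add1n => -[<-]; apply/eq_leq/eq_card => z; rewrite !inE andbT.
by rewrite mem_enum.
Qed.

Lemma primitive_path u m :
  path (fun y z => z == g * y) u (traject ( *%R g) (g * u) m).
Proof.
by elim: m u => //= m IHm u; rewrite eqxx IHm.
Qed.

End PrimitiveCycle.

(** * Choice of the cut and of the insertion places *)

Section Directions.

Variables (F : finFieldType) (r : F).
Hypothesis r_neq0 : r != 0.
Hypothesis char2 : 2%:R != 0 :> F.

(* Adding x / r after x, whenever this is new, makes x / r available up to sign
   for every element except the latest, which becomes e ord0. *)
Lemma directions_exist m : (m.*2.+2 < #|F|)%N ->
  exists e : 'I_m.+1 -> F,
  [/\ forall i, e i != 0, injective e, forall i j, e i != - e j &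
      forall j, exists i, e (lift ord0 j) = r * e i \/ e (lift ord0 j) = - (r * e i)].
Proof.
move=> cardF.
have opp_neq (x : F) : x != 0 -> x != - x.
  by move=> x0; rewrite -subr_eq0 opprK -mulr2n -mulr_natl mulf_neq0.
(* The list grows at its head, which becomes [e ord0]; [behead s] holds the elements already
   provided for. *)
suff [s] : exists s : seq F, [/\ size s = m.+1, uniq s, 0 \notin s,
    forall x y, x \in s -> y \in s -> x != - y &
    forall x, x \in behead s -> exists2 y, y \in s & x = r * y \/ x = - (r * y)].
  move=> [sz us s0 sopp sr]; exists (fun i => s`_i).
  have mems (i : 'I_m.+1) : s`_i \in s by rewrite mem_nth ?sz.
  split=> [i|i j|i j|j].
  - by apply: contraNneq s0 => <-.
  - by move/eqP; rewrite nth_uniq ?sz // => /eqP/val_inj.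
  - exact: sopp.
  have [|y ys E] := sr (s`_(lift ord0 j)).
    by rewrite lift0 -nth_behead mem_nth // size_behead sz.
  have yi : (index y s < m.+1)%N by rewrite -sz index_mem.
  by exists (Ordinal yi); rewrite /= nth_index.
elim: m cardF => [|m IHm] cardF.
  exists [:: 1]; split=> //; first by rewrite inE eq_sym oner_eq0.
  by move=> x y; rewrite !inE => /eqP-> /eqP->; apply: opp_neq; exact: oner_neq0.
have [|s [sz us s0 sopp sr]] := IHm; first by apply: leq_trans cardF; lia.
case: s sz us s0 sopp sr => // c s [sz] us s0 sopp sr.
pose avoid := 0 :: (c :: s) ++ map -%R (c :: s).
(* If c / r is new, it is the next element. Otherwise, being nonzero, it is plus or minus an element
   of the list, so c is provided for and any y outside [avoid] will do; counting gives one. *)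
have [y yav cy] : exists2 y, y \notin avoid &
    exists2 z, z \in y :: c :: s & c = r * z \/ c = - (r * z).
  have [|cav] := boolP (c / r \in avoid); last first.
    by exists (c / r) => //; exists (c / r); rewrite ?inE ?eqxx //; left; rewrite mulrC divfK.
  have [y yav] : exists y, y \notin avoid.
    apply/existsP; rewrite -negb_forall; apply: contraL cardF => /forallP all_av.
    rewrite -leqNgt (leq_trans (n := size avoid)) //.
      by rewrite cardE uniq_leq_size ?enum_uniq.
    by rewrite /= size_cat /= size_map sz -addnn; lia.
  rewrite in_cons mulf_eq0 invr_eq0 (negPf r_neq0) orbF.
  have c0 : (c == 0) = false by apply: contraNF s0 => /eqP->; rewrite inE eqxx.
  rewrite c0 orFb mem_cat => cav; exists y => //; case/orP: cav => cs.
     by exists (c / r); [rewrite in_cons cs orbT | left; rewrite mulrC divfK].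
  have /mapP[z zs cz] := cs.
  exists z; first by rewrite in_cons zs orbT.
  by right; rewrite -mulrN -cz mulrC divfK.
exists (y :: c :: s); move: yav; rewrite in_cons mem_cat (negb_or (y == 0)) (negb_or (y \in c :: s)) => /and3P[y0 ys yNs].
have yopp z : z \in c :: s -> y != - z.
  by apply: contraTneq => yz; apply: contra yNs => zs; rewrite yz map_f.
split=> //=; rewrite ?sz //.
- by rewrite ys.
- by rewrite inE eq_sym negb_or y0.
- move=> x z; rewrite [x \in _]inE [z \in _]inE => /predU1P[->|xs] /predU1P[->|zs].
  + exact: opp_neq.
  + exact: yopp.
  + by apply: contraTneq (yopp _ xs) => ->; rewrite opprK negbK.
  + exact: sopp.
move=> x; rewrite inE => /predU1P[->|xs]; first exact: cy.
by have [z zs E] := sr x xs; exists z; rewrite // inE zs orbT.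
Qed.

End Directions.

(** * Primitive roots and progressions modulo a prime *)

Section PrimeField.

Variable p : nat.
Hypothesis p_prime : prime p.

Lemma natr_Fp_inj i j : (i < p)%N -> (j < p)%N -> i%:R = j%:R :> 'F_p -> i = j.
Proof.
move=> ip jp /(congr1 (@nat_of_ord _)).
by rewrite !val_Fp_nat // !modn_small.
Qed.

Lemma natr_Fp_val (a : 'F_p) : exists2 t, (t < p)%N & t%:R = a.
Proof.
exists (val a); first by rewrite -[X in (_ < X)%N](Fp_cast p_prime) ltn_ord.
by rewrite natr_Zp.
Qed.

(** By Fermat the p - 1 nonzero elements are distinct roots of unity for the exponent p - 1, so
    [has_prim_root] applies. *)
Lemma Fp_prim_root : exists g : 'F_p, p.-1.-primitive_root g.
Proof.
have p1 := prime_gt1 p_prime.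
have /hasP[g _ g_prim] : has p.-1.-primitive_root (enum [pred x : 'F_p | x != 0]).
  apply: has_prim_root; first by case: p p1 => [|[]].
  - apply/allP => x; rewrite mem_enum inE => x0; apply/unity_rootP.
    apply: (mulfI x0); rewrite -exprS prednK ?prime_gt0 // mulr1.
    have [t _ <-] := natr_Fp_val x; rewrite -natrX.
    by apply: val_inj; rewrite /= !val_Fp_nat // fermat_little.
  - exact: enum_uniq.
  rewrite -cardE -ltnS prednK ?prime_gt0 // -[X in (X <= _)%N](card_Fp p_prime).
  by rewrite (cardD1 0) inE add1n ltnS; apply/eq_leq/eq_card => x; rewrite !inE andbT.
by exists g.
Qed.

Definition progression (w d : 'F_p) := mkseq (fun t => w + d *+ t) p.

Lemma progression_uniq w d : d != 0 -> uniq (progression w d).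
Proof.
move=> d0; rewrite map_inj_in_uniq ?iota_uniq // => i j.
rewrite !mem_iota /= !add0n => ip jp /addrI.
by rewrite -![d *+ _]mulr_natr => /(mulfI d0)/natr_Fp_inj->.
Qed.

(** The progression is the cycle of step [d] through F_p, opened just before [w]. *)
Lemma adjacent_progression w d a : d != 0 -> a + d != w ->
  adjacent (progression w d) a (a + d).
Proof.
move=> d0 adw; have [t tp Et] := natr_Fp_val ((a - w) / d).
have Ea : a = w + d *+ t by rewrite -mulr_natr Et mulrC divfK // addrC subrK.
have tp1 : (t < p.-1)%N.
  rewrite ltnNge; apply: contraNN adw => pt.
  have Et1 : t.+1 = p by lia.
  by rewrite Ea -addrA -mulrSr Et1 mulrn_pchar ?addr0 // pchar_Fp.
apply/orP; left; rewrite steps_mkseq; apply/mapP; exists t; first by rewrite mem_iota.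
by rewrite mulrSr addrA -Ea.
Qed.

Lemma progression_adjacent w d a b :
  adjacent (progression w d) a b -> b = a + d \/ a = b + d.
Proof.
rewrite /adjacent steps_mkseq => /orP[] /mapP[t _ [-> ->]].
  by left; rewrite mulrSr addrA.
by right; rewrite mulrSr addrA.
Qed.

End PrimeField.

(** * Paths through a disjoint union *)

Section Sum.

Variables (T U : eqType).
Implicit Types (s : seq T) (t : seq U).

Definition sum_seq s t : seq (T + U) := map inl s ++ map inr t.

(** Only the junction joins the two sides, so one path can serve each side independently. *)
Lemma steps_sum_seq s t : s != [::] ->
  exists junction, steps (sum_seq s t) =
  map (fun x => (inl x.1, inl x.2)) (steps s) ++
  junction ++ map (fun x => (inr x.1, inr x.2)) (steps t) /\
  all (fun x => if x is (inl _, inr _) then true else false) junction.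
Proof.
case: s => // x s _; case: t => [|y t].
  by exists [::]; rewrite /sum_seq cats0 map_steps /= cats0.
exists [:: (inl (last x s), inr y)]; split=> //.
by rewrite /sum_seq !map_cons steps_cat last_map -!map_cons !map_steps.
Qed.

Lemma uniq_sum_seq s t : uniq s -> uniq t -> uniq (sum_seq s t).
Proof.
move=> us ut; rewrite cat_uniq !map_inj_uniq ?us ?ut ?andbT /=; try by move=> ? ? [].
by apply/hasPn => _ /mapP[y _ ->]; apply/mapP => -[].
Qed.

Lemma adjacent_sum_ll s t a b :
  adjacent (sum_seq s t) (inl a) (inl b) = adjacent s a b.
Proof.
case: s => [|x s]; first by rewrite /adjacent /sum_seq map_steps /=;
  apply/negP => /orP[] /mapP[].
have [J [E /allP J_lr]] := steps_sum_seq (s := x :: s) t isT.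
have H c d : ((inl c, inl d) \in steps (sum_seq (x :: s) t)) = ((c, d) \in steps (x :: s)).
  rewrite E !mem_cat (mem_map (f := fun x => (inl x.1, inl x.2)) _ _ (c, d)).
    rewrite [X in _ || (_ || X)](_ : _ = false); last by apply/mapP => -[].
    by rewrite orbF; case: (boolP (_ \in J)) => [/J_lr|]; rewrite ?orbF.
  by case=> [? ?] [? ?] [-> ->].
by rewrite /adjacent !H.
Qed.

Lemma adjacent_sum_rr s t a b : s != [::] ->
  adjacent (sum_seq s t) (inr a) (inr b) = adjacent t a b.
Proof.
move=> s0; have [J [E /allP J_lr]] := steps_sum_seq t s0.
have H c d : ((inr c, inr d) \in steps (sum_seq s t)) = ((c, d) \in steps t).
  rewrite E !mem_cat (mem_map (f := fun x => (inr x.1, inr x.2)) _ _ (c, d)).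
    rewrite [X in X || _](_ : _ = false); last by apply/mapP => -[].
    by case: (boolP (_ \in J)) => [/J_lr|].
  by case=> [? ?] [? ?] [-> ->].
by rewrite /adjacent !H.
Qed.

End Sum.

(** * Assembly of the system on p + f vertices *)

Lemma same_edge_adjacent (T : eqType) (s : seq T) u v x y :
  same_edge u v x y -> adjacent s u v = adjacent s x y.
Proof. by case/orP=> /andP[/eqP-> /eqP->] //; exact: adjacentC. Qed.

(** Rotations separate edges with different signatures; of the pairs left by [signature_eq], edges
    between extra points are separated by [G] and short edges by the progressions. *)
Lemma separating_sum p f (G : nat -> seq 'I_f) :
  prime p -> (4 < p)%N -> (f.*2.+2 < p)%N -> separating G f.+1 ->
  exists G' : nat -> seq ('F_p + 'I_f), separating G' (p + f.+1).
Proof.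
move=> p_prime p4 fp [uG sepG].
have ltfp : (f.+1 <= p)%N by lia.
have [n pn] : exists n, p = n.+2 by exists p.-2; lia.
have p1n : p.-1 = n.+1 by rewrite pn.
have [g g_prim] := Fp_prim_root p_prime.
have g_expE k : (g ^+ k == 1) = (p.-1 %| k)%N by rewrite -(prim_order_dvd g_prim).
have g1 : g != 1.
  by rewrite -[g]expr1 g_expE; apply/negP => /dvdn_leq; lia.
have gN1 : g != -1.
  apply/eqP => gN; have : g ^+ 2 == 1 by rewrite gN sqrrN expr1n.
  by rewrite g_expE => /dvdn_leq; lia.
have gB1 : g - 1 != 0 by rewrite subr_eq0.
have gD1 : g + 1 != 0 by rewrite addr_eq0.
have two0 : 2%:R != 0 :> 'F_p.
  by apply/eqP => /(natr_Fp_inj p_prime (i := 2) (j := 0)); lia.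
have r0 : (g + 1) / (g - 1) != 0 by rewrite mulf_neq0 ?invr_eq0.
have cardFp : (f.*2.+2 < #|{: 'F_p}|)%N by rewrite card_Fp.
have [e [e0 e_inj e_opp e_cl]] := directions_exist r0 two0 cardFp.
have e_closed j : exists i, (g - 1) * e (lift ord0 j) = (g + 1) * e i \/
    (g - 1) * e (lift ord0 j) = - ((g + 1) * e i).
  have [i [->|->]] := e_cl j; exists i; [left | right]; by field.
rewrite p1n in g_prim.
(* Started at g * e ord0, the cycle of p - 1 elements ends at [e ord0], where it is to be cut. *)
pose x0 := g * e ord0; pose xs := traject ( *%R g) (g * x0) n.
have g0 := prim_root_neq0 g_prim.
have x00 : x0 != 0 by rewrite mulf_neq0.
have xs_path := primitive_path g x0 n.
have xs_uniq : uniq (x0 :: xs) := primitive_traject_uniq g_prim x00.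
have cardF : #|{: 'F_p}| = n.+2 by rewrite card_Fp.
have mem_xs y : (y \in x0 :: xs) = (y != 0).
  exact: (mem_primitive_traject cardF g_prim y x00).
have last_xs : last x0 xs = e ord0.
  by rewrite last_traject iter_mull mulrA -exprSr (prim_expr_order g_prim) mul1r.
have sigE t u v := rotation_signature g1 e0 e_inj xs_path xs_uniq mem_xs last_xs t (u := u) (v := v).
(* Starting at k - e k, this progression misses the edge of its difference that
   only rotation k uses, so different progressions miss edges of different
   rotations. *)
pose R k : seq 'F_p := let i : 'I_f.+1 := inord k in
  progression (k%:R - e i) ((g - 1) * e i).
pose G' k := if (k < p)%N then rotation e x0 xs k%:R
  else sum_seq (R (k - p)%N) (G (k - p)%N).
have d0 i : (g - 1) * e i != 0 by rewrite mulf_neq0.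
have R0 k : R k != [::] by rewrite -size_eq0 size_mkseq -lt0n prime_gt0.
exists G'; split=> [k|u v w z uv wz uvwz].
  rewrite /G'; case: ifP => _; last first.
    by rewrite uniq_sum_seq // progression_uniq.
  by rewrite map_inj_uniq ?uniq_base_path //; exact: shift_inj.
have [|] := boolP [exists t : 'F_p, (t \in signature g e u v) != (t \in signature g e w z)].
  case/existsP=> t; have [k kp <-] := natr_Fp_val p_prime t => kuv.
  exists k; first by rewrite (leq_trans kp) ?leq_addr.
  by rewrite /G' kp !sigE.
rewrite negb_exists => /forallP sig_eq.
have G'R k : G' (p + k)%N = sum_seq (R k) (G k).
  by rewrite /G' ltnNge leq_addr /= addKn.
case: (signature_eq g1 gN1 e0 e_inj e_opp e_closed uv wz).
- by move=> t; apply/eqP; rewrite -[_ == _]negbK.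
- by rewrite (negPf uvwz).
- move=> [i [j [k [l [ui vj wk zl]]]]]; rewrite {}ui {}vj {}wk {}zl in uv wz uvwz sig_eq *.
  have [||//|m mf sep] := sepG i j k l.
  + by apply: contraNneq uv => ->.
  + by apply: contraNneq wz => ->.
  by exists (p + m)%N; rewrite ?ltn_add2l // G'R !adjacent_sum_rr.
move=> [a [b [i [c [d [j [[uv_ab si] [wz_cd sj] bd]]]]]]].
have Eb : b = a + (g - 1) * e i by rewrite -si; exact: slopeE.
have Ed : d = c + (g - 1) * e j by rewrite -sj; exact: slopeE.
have [ij|ij] := eqVneq i j.
  case/negP: uvwz; apply: (same_edge_trans uv_ab).
  move: bd; rewrite ij => /addIr bd; move: Eb; rewrite bd {1}Ed ij => /addIr <-.
  exact: wz_cd.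
(* The k-th progression contains every edge of slope [e k] except the one ending at its start, and
   none of slope [e l], as [e l] is neither [e k] nor [- e k]. *)
have sep (k l : 'I_f.+1) (x y x' y' : 'F_p) : k != l -> x' = x + (g - 1) * e k ->
    y' = y + (g - 1) * e l -> x' + e k != k%:R ->
    adjacent (G' (p + k)%N) (inl x) (inl x') && ~~ adjacent (G' (p + k)%N) (inl y) (inl y').
  move=> kl Ex Ey xk; rewrite G'R !adjacent_sum_ll /R inord_val; apply/andP; split.
    by rewrite Ex adjacent_progression // -Ex -subr_eq0 opprB addrA subr_eq0.
  apply: contra kl => /progression_adjacent.
  rewrite Ey => -[/addrI/(mulfI gB1)/e_inj-> // | E].
  case/eqP: (e_opp l k); apply: (mulfI gB1).
  by apply: (addrI y); rewrite mulrN; apply: (addIr ((g - 1) * e k)); rewrite -E; ring.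
(* b + e i = d + e j is the one rotation using either edge. Unless it is [i%:R], path p + i uses the
   first edge only; if it is, it differs from [j%:R] because i and j are distinct and below p, and
   path p + j uses the second only. *)
have [bi|bi] := eqVneq (b + e i) i%:R; last first.
  exists (p + i)%N; first by rewrite ltn_add2l.
  rewrite (same_edge_adjacent _ uv_ab) (same_edge_adjacent _ wz_cd).
  by have /andP[-> /negPf->] := sep i j _ _ _ _ ij Eb Ed bi.
exists (p + j)%N; first by rewrite ltn_add2l.
rewrite (same_edge_adjacent _ uv_ab) (same_edge_adjacent _ wz_cd).
have ji : j != i by rewrite eq_sym.
have dj : d + e j != j%:R.
  rewrite -bd bi; apply: contra ij => /eqP/(natr_Fp_inj p_prime) ij.
  by apply/eqP/val_inj/ij; apply: leq_trans (ltn_ord _) ltfp.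
by have /andP[-> /negPf->] := sep j i _ _ _ _ ji Ed Eb dj.
Qed.

(** * Small cases and the induction *)

Local Open Scope nat_scope.

Definition separates_below (n : nat) (L : seq (seq nat)) : bool :=
  all (fun s => uniq s && all (gtn n) s) L &&
  all (fun a => all (fun b => all (fun c => all (fun d =>
    [|| a == b, c == d, same_edge a b c d |
        has (fun s => adjacent s a b != adjacent s c d) L])
    (iota 0 n)) (iota 0 n)) (iota 0 n)) (iota 0 n).

Lemma separates_belowP n L : separates_below n.+1 L ->
  exists G : nat -> seq 'I_n.+1, separating G (size L).
Proof.
case/andP=> /allP okL /allP sepL.
have valK s : s \in L -> map val (map (@inord n) s) = s.
  move=> /okL/andP[_ /allP sn]; rewrite -map_comp; apply: map_id_in => x /sn xn.
  by rewrite /= inordK.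
exists (fun i => map (@inord n) (nth [::] L i)); split=> [i|a b c d ab cd abcd].
  have [iL|Li] := ltnP i (size L); last by rewrite nth_default.
  have Gi := mem_nth [::] iL.
  by rewrite -(map_inj_uniq val_inj) valK //; case/andP: (okL _ Gi).
have In (x : 'I_n.+1) : val x \in iota 0 n.+1 by rewrite mem_iota ltn_ord.
move: (sepL _ (In a)) => /allP/(_ _ (In b))/allP/(_ _ (In c))/allP/(_ _ (In d)).
rewrite !val_eqE (negPf ab) (negPf cd) /= => /orP[|/(has_nthP [::])[i iL sep]].
  by move: abcd; rewrite /same_edge !val_eqE => /negPf->.
exists i => //; rewrite -!(map_adjacent _ _ _ val_inj) valK //; exact: mem_nth.
Qed.

Lemma separating_leq (T : eqType) (G : nat -> seq T) k l :
  k <= l -> separating G k -> separating G l.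
Proof.
move=> kl [uG sepG]; split=> // a b c d ab cd abcd.
by have [i ik sep] := sepG _ _ _ _ ab cd abcd; exists i => //; apply: leq_trans kl.
Qed.

Lemma separating_card (T : finType) (G : nat -> seq T) n k :
  #|T| = n -> separating G k -> exists H : nat -> seq 'I_n, separating H k.
Proof.
by move=> <- /(separating_bij (@enum_rank_bij T)); exists (fun i => map enum_rank (G i)).
Qed.

(* In Z/10, the offset between the two edges of difference d, 0 < d < 5, takes
   each of the values 1, 2, 3, 4 up to sign, and 5 occurs once as a difference. *)
Definition generator_path10 := [:: 0; 1; 2; 5; 8; 6; 4; 9; 3; 7].

(** With f = n - p, the condition 2n + 3 <= 3p says 2f + 3 <= p, and the path count is p + (f + 1) =
    n + 1. *)
Lemma separating_complete n : exists G : nat -> seq 'I_n, separating G n.+1.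
Proof.
elim/ltn_ind: n => n IHn.
have small L : 0 < n -> separates_below n L -> size L <= n.+1 ->
    exists G : nat -> seq 'I_n, separating G n.+1.
  case: n {IHn} => // n _ /separates_belowP[G sepG] Ln.
  by exists G; apply: separating_leq sepG.
(* Up to n = 2 there is at most one edge; for n = 3 and n = 4 all edges but one are taken as
   one-edge paths. *)
have [n5|n5] := ltnP n 5.
  case: n n5 {IHn} small => [|[|[|[|[|n]]]]] // _ small.
  - by exists (fun=> [::]); split=> // -[].
  - exact: (small [::]).
  - exact: (small [::]).
  - exact: (small [:: [:: 0; 1]; [:: 1; 2]]).
  - exact: (small [:: [:: 0; 1]; [:: 0; 2]; [:: 0; 3]; [:: 1; 2]; [:: 1; 3]]).
(* For n = 10 the bound 23 <= 3p would need a prime among 8, 9 and 10; the ten translates of a path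
   in Z/10 are used instead. *)
have [n10|n10] := eqVneq n 10.
  move: small; rewrite n10 => small.
  pose rotations := [seq [seq (x + i) %% 10 | x <- generator_path10] | i <- iota 0 10].
  have sep10 : separates_below 10 rotations by vm_compute.
  exact: small sep10 _.
have [p [p_prime pn np]] : exists p, [/\ prime p, p <= n & 2 * n + 3 <= 3 * p].
  have [/prime_interval//|le10] := ltnP 10 n.
  (* The prime 5 serves n = 5, 6 and the prime 7 serves n = 7, 8, 9. *)
  by have [n7|n7] := ltnP n 7; [exists 5 | exists 7]; split=> //; lia.
have [G sepG] := IHn (n - p) ltac:(have := prime_gt0 p_prime; lia).
have [||G' sepG'] := separating_sum p_prime _ _ sepG; [lia|lia|].
have <- : p + (n - p).+1 = n.+1 by lia.
by apply: separating_card sepG'; rewrite card_sum card_Fp // card_ord subnKC.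
Qed.

Theorem theorem1 (n : nat) : wsp (complete_graph n) <= n.+1.
Proof.
by have [G sepG] := separating_complete n; exact: separating_wsp sepG.
Qed.
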